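(* Let $G$ be an $r$-uniform hypergraph with $m$ edges and let $1\le p<r$. If $G$ is $\alpha$-subnormal for $p$, then \[ \lambda^{(p)}(G)\leq\frac{(r/m)^{1-r/p}}{\alpha^{1/p}}. \]
   Context: An $r$-uniform hypergraph $G$ consists of a finite vertex set $V(G)=\{1,\dots,n\}$ and a set $E(G)$ of $r$-element subsets of $V(G)$ (edges). For $\bm{x}\in\mathbb{R}^n$ let $P_G(\bm{x})=r\sum_{\{i_1,\ldots,i_r\}\in E(G)}x_{i_1}\cdots x_{i_r}$, $\|\bm{x}\|_p=(\sum_i|x_i|^p)^{1/p}$, and $\lambda^{(p)}(G)=\max_{\|\bm{x}\|_p=1}P_G(\bm{x})$. A weighted incidence matrix of $G$ is a $|V(G)|\times|E(G)|$ real matrix $B$ with $B(v,e)>0$ if $v\in e$ and $B(v,e)=0$ if $v\notin e$. For $1\le p<r$ and $\alpha>0$, a hypergraph $G$ with $m$ edges is $\alpha$-subnormal for $p$ if there is a weighted incidence matrix $B$ with (1) $\sum_{e\ni v}B(v,e)\le1$ for every $v\in V(G)$, and (2) $m^{r-p}\prod_{v\in e}B(v,e)\ge\alpha$ for every $e\in E(G)$. *)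

(* Defs.v *)
From mathcomp Require Export all_boot all_order all_algebra.
From mathcomp Require Export all_classical all_reals all_analysis.

Set Implicit Arguments.
Unset Strict Implicit.
Unset Printing Implicit Defensive.

Import Order.TTheory GRing.Theory Num.Theory.
Import numFieldNormedType.Exports.

Local Open Scope classical_set_scope.
Local Open Scope ring_scope.

Record hypergraph (r n : nat) := Hypergraph {
  edges : {set {set 'I_n}};
  edges_uniform : forall e : {set 'I_n}, e \in edges -> #|e| = r }.

Section Lambda.
Context {R : realType} (p : R) {r n : nat} (G : hypergraph r n).

Definition lpnorm (x : 'rV[R]_n) : R :=
  (\sum_(i < n) `|x ord0 i| `^ p) `^ p^-1.

Definition lagrangian_poly (x : 'rV[R]_n) : R :=
  r%:R * \sum_(e in edges G) \prod_(i in e) x ord0 i.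

(* [sup] is total; lemma [lambda_max] below shows that for 1 <= p and 0 < n
   this supremum is a maximum over the unit sphere. For n = 0 the sphere is
   empty and the value is 0. *)
Definition lambda : R :=
  sup [set lagrangian_poly x | x in [set x | lpnorm x = 1]].

(* The columns of B are indexed by 'I_#|edges G|; column j is the edge
   [enum_val j]. *)
Definition weighted_incidence (B : 'M[R]_(n, #|edges G|)) : Prop :=
  forall (v : 'I_n) (j : 'I_#|edges G|),
    (v \in enum_val j -> 0 < B v j) /\ (v \notin enum_val j -> B v j = 0).

Definition subnormal (alpha : R) : Prop :=
  exists B : 'M[R]_(n, #|edges G|),
    [/\ weighted_incidence B,
        forall v : 'I_n, \sum_(j < #|edges G| | v \in enum_val j) B v j <= 1
      & forall j : 'I_#|edges G|,
          alpha <= #|edges G|%:R `^ (r%:R - p) *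
                   \prod_(v in enum_val j) B v j ].

End Lambda.

Section LambdaMax.
Context {R : realType} (p : R) {r n : nat} (G : hypergraph r n) (p1 : 1 <= p).

Let p_gt0 : 0 < p. Proof. exact: lt_le_trans p1. Qed.

Lemma continuous_norm_powR : continuous (fun a : R => `|a| `^ p).
Proof.
move=> a; have [->|a0] := eqVneq a 0; last first.
  apply: (@continuous_comp _ _ _ (fun a : R => `|a|) (fun a : R => a `^ p)).
    exact: norm_continuous.
  apply/differentiable_continuous/derivable1_diffP/derivable_powR.
  by rewrite in_itv/= normr_gt0 a0.
rewrite /continuous_at normr0 powR0 ?gt_eqF//.
apply: (@squeeze_cvgr _ _ _ _ (fun=> 0) (fun a : R => `|a|)).
- near=> x; rewrite powR_ge0/=.
  have [->|x0] := eqVneq x 0; first by rewrite normr0 powR0// gt_eqF.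
  apply: ge1r_powR => //; rewrite normr_gt0 x0/=.
  near: x; apply/nbhs_ballP; exists 1 => //= y.
  by rewrite /ball/= sub0r normrN => /ltW.
- exact: cvg_cst.
- by rewrite -[X in _ --> X](@normr0 _ R); exact: norm_continuous.
Unshelve. all: by end_near. Qed.

Lemma continuous_sum_powR :
  continuous (fun x : 'rV[R]_n => \sum_(i < n) `|x ord0 i| `^ p).
Proof.
apply: (@continuous_big _ _ +%R 0); first exact: add_continuous.
move=> i _ x.
apply: (@continuous_comp _ _ _ (fun x : 'rV[R]_n => x ord0 i)
  (fun a : R => `|a| `^ p)); first exact: coord_continuous.
exact: continuous_norm_powR.
Qed.

Lemma lpnorm_eq1 (x : 'rV[R]_n) :
  (lpnorm p x = 1) <-> (\sum_(i < n) `|x ord0 i| `^ p = 1).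
Proof.
have s0 : 0 <= \sum_(i < n) `|x ord0 i| `^ p.
  by apply: sumr_ge0 => i _; exact: powR_ge0.
split=> [/eqP|]; last by rewrite /lpnorm => ->; rewrite powR1.
rewrite powR_eq1 invr_eq0 (gt_eqF p_gt0) orbF ltNge s0 orbF.
by move/eqP.
Qed.

Lemma compact_lpsphere : compact [set x : 'rV[R]_n | lpnorm p x = 1].
Proof.
have C : compact [set x : 'rV[R]_n |
    forall i, [set` `[(-1 : R), 1]] (x ord0 i)].
  by apply: (@rV_compact _ n (fun=> [set` `[(-1 : R), 1]])) => i;
     exact: segment_compact.
apply: (subclosed_compact _ C).
- have -> : [set x : 'rV[R]_n | lpnorm p x = 1] =
      (fun x : 'rV[R]_n => \sum_(i < n) `|x ord0 i| `^ p) @^-1` [set 1].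
    by apply/seteqP; split=> x /= /lpnorm_eq1.
  move/continuous_closedP: continuous_sum_powR; apply.
  exact/accessible_closed_set1/hausdorff_accessible/Rhausdorff.
- move=> x /= /lpnorm_eq1 x1 i; rewrite in_itv/= -ler_norml.
  rewrite leNgt; apply/negP => xi.
  suff : 1 < \sum_(i < n) `|x ord0 i| `^ p by rewrite x1 ltxx.
  rewrite (bigD1 i)//= ltr_wpDr//.
    by apply: sumr_ge0 => j _; exact: powR_ge0.
  by apply: (lt_le_trans xi); rewrite le1r_powR// ltW.
Qed.

Lemma lambda_max : (0 < n)%N ->
  exists2 x : 'rV[R]_n, lpnorm p x = 1 &
    lagrangian_poly G x = lambda p G /\
    forall y, lpnorm p y = 1 -> lagrangian_poly G y <= lambda p G.
Proof.
move=> n0; set S := [set x : 'rV[R]_n | lpnorm p x = 1].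
have S0 : S !=set0.
  exists (delta_mx ord0 (Ordinal n0)); apply/lpnorm_eq1.
  rewrite (bigD1 (Ordinal n0))//= big1 ?addr0 => [|i in0].
    by rewrite mxE !eqxx normr1 powR1.
  by rewrite mxE eqxx (negbTE in0) normr0 powR0// gt_eqF.
have cP : continuous (lagrangian_poly G : 'rV[R]_n -> R).
  have cS : continuous (fun x : 'rV[R]_n =>
      \sum_(e in edges G) \prod_(i in e) x ord0 i).
    apply: (@continuous_big _ _ +%R 0); first exact: add_continuous.
    move=> e _; apply: (@continuous_big R _ *%R 1); first exact: mul_continuous.
    by move=> i _; exact: coord_continuous.
  move=> x; rewrite /continuous_at /lagrangian_poly.
  apply: (@cvgM R _ (nbhs x) _ (fun=> r%:R) _ r%:R); last exact: cS.
  exact: cvg_cst.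
have [c /set_mem Sc maxc] := EVT_max_rV S0 compact_lpsphere
  (continuous_subspaceT cP).
have ubP : ubound [set lagrangian_poly G x | x in S] (lagrangian_poly G c).
  by move=> _ [y Sy <-]; apply: maxc; rewrite inE.
have le_sup y : S y -> lagrangian_poly G y <= lambda p G.
  by move=> Sy; apply: ub_le_sup; [exists (lagrangian_poly G c) | exists y].
exists c => //; split; last exact: le_sup.
apply/eqP; rewrite eq_le le_sup//=; apply: ge_sup => //.
by exists (lagrangian_poly G c), c.
Qed.

End LambdaMax.

(* Main.v *)
Require Import Defs.
From mathcomp Require Import ring.
Import Order.TTheory GRing.Theory Num.Theory.
Local Open Scope ring_scope.

(** For an edge [e] put [s_e = \sum_(v in e) B(v,e) |x_v|^p]. Condition (2) and
    AM-GM bound [(\prod_(v in e) |x_v|)^p] by [m^(r-p) / alpha * (s_e / r)^r].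
    By condition (1) the numbers [s_e] sum to at most [\sum_v |x_v|^p = 1]; in
    particular [s_e <= 1], hence [s_e^(r/p) <= s_e] because [p <= r], and
    summing the [p]-th roots over the edges gives the bound. *)

Lemma powR_inv_base (R : realType) (x a : R) : 0 <= x -> x^-1 `^ a = x `^ (- a).
Proof. by move=> x0; rewrite -powR_inv1// -powRrM mulN1r. Qed.

Lemma powR_prod (R : realType) (I : finType) (P : pred I) (F : I -> R) (a : R) :
  (forall i, P i -> 0 <= F i) ->
  (\prod_(i | P i) F i) `^ a = \prod_(i | P i) F i `^ a.
Proof.
move=> F0.
(* Nonnegativity of the partial products is carried through the induction because [powRM] needs it
   for both factors. *)
suff [] : 0 <= \prod_(i | P i) F i /\
    (\prod_(i | P i) F i) `^ a = \prod_(i | P i) F i `^ a by [].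
apply: (big_ind2 (fun x y : R => 0 <= x /\ x `^ a = y)) => [|x _ y _ [x0 <-] [y0 <-]|i Pi].
- by rewrite powR1.
- by rewrite mulr_ge0// powRM.
- by split=> //; exact: F0.
Qed.

(** The estimate for one edge. The root of the AM-GM bound produces [s] to the power [#|A| / p];
    this exponent is at least 1 and [s] lies in [0, 1], so the power is at most [s]. Being linear in
    [s], the bound can be summed over edges. *)
Lemma prod_norm_le_weighted_sum (R : realType) (I : finType) (A : {set I})
    (b x : I -> R) (p c : R) (s := \sum_(i in A) b i * `|x i| `^ p) :
  0 < p -> p <= #|A|%:R -> 0 < c -> (forall i, i \in A -> 0 <= b i) ->
  c <= \prod_(i in A) b i -> s <= 1 ->
  \prod_(i in A) `|x i| <=
    c^-1 `^ p^-1 * #|A|%:R^-1 `^ (#|A|%:R / p) * s.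
Proof.
move=> p0 pA c0 b0 cb s1.
have s0 : 0 <= s by apply: sumr_ge0 => i iA; rewrite mulr_ge0 ?b0// powR_ge0.
have X0 : 0 <= \prod_(i in A) `|x i| by exact: prodr_ge0.
have pth_power_le : (\prod_(i in A) `|x i|) `^ p <= c^-1 * (s / #|A|%:R) ^+ #|A|.
  rewrite ler_pdivlMl// powR_prod//.
  apply: (@le_trans _ _ (\prod_(i in A) (b i * `|x i| `^ p))).
    rewrite big_split/= ler_wpM2r//.
    by apply: prodr_ge0 => i _; exact: powR_ge0.
  have [i iA|-> //] := @leif_AGM R I (mem A) (fun i => b i * `|x i| `^ p).
  by rewrite mulr_ge0 ?b0// powR_ge0.
have sA0 : 0 <= s / #|A|%:R by rewrite divr_ge0.
have -> : \prod_(i in A) `|x i| = ((\prod_(i in A) `|x i|) `^ p) `^ p^-1.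
  by rewrite -powRrM divff ?gt_eqF// powRr1.
apply: (@le_trans _ _ ((c^-1 * (s / #|A|%:R) ^+ #|A|) `^ p^-1)).
  apply: ge0_ler_powR => //; rewrite ?nnegrE ?invr_ge0 ?(ltW p0) ?powR_ge0//.
  by rewrite mulr_ge0 ?invr_ge0 ?(ltW c0)// exprn_ge0.
rewrite powRM ?invr_ge0 ?(ltW c0)// ?exprn_ge0//.
rewrite -(powR_mulrn _ sA0) -powRrM (powRM _ s0) ?invr_ge0// [s `^ _ * _]mulrC mulrA.
rewrite ler_wpM2l ?mulr_ge0 ?powR_ge0//.
have r1 : 1 <= #|A|%:R / p by rewrite ler_pdivlMr ?mul1r.
(* [ge1r_powR] needs a positive base; for [s = 0] both sides vanish, the exponent being nonzero. *)
have [s_pos|] := ltP 0 s; first by rewrite ge1r_powR ?s_pos.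
move=> /(conj s0)/andP/le_anti <-.
by rewrite powR0// gt_eqF// (lt_le_trans ltr01).
Qed.

Theorem theorem4p4 (R : realType) (r n m : nat) (p alpha : R)
    (G : hypergraph r n) (hm : #|edges G| = m)
    (hp1 : 1 <= p) (hpr : p < r%:R) (halpha : 0 < alpha)
    (hG : subnormal p G alpha) :
  lambda p G <= (r%:R / m%:R) `^ (1 - r%:R / p) / alpha `^ p^-1.
Proof.
have p0 : 0 < p by exact: lt_le_trans hp1.
have r0 : 0 < r%:R :> R by exact: lt_trans hpr.
set K := leRHS.
have K0 : 0 <= K by rewrite divr_ge0 ?powR_ge0.
rewrite /lambda; set S := [set _ | x in _]%classic.
(* The unit sphere is empty when [n = 0]; then [sup] takes its default value 0, and [K0]
   suffices. *)
have [->|S0] := eqVneq S set0; first by rewrite sup0.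
apply: ge_sup; first exact/set0P.
move=> _ [x /= /(lpnorm_eq1 hp1) x1 <-].
have [m0|m_gt0] := posnP m.
  rewrite /lagrangian_poly big_pred0 ?mulr0// => e.
  by move: hm; rewrite m0 => /card0_eq/(_ e).
have {}m_gt0 : 0 < m%:R :> R by rewrite ltr0n.
have [B [incB rowB prodB]] := hG.
pose s (j : 'I_#|edges G|) := \sum_(v in enum_val j) B v j * `|x ord0 v| `^ p.
have B0 v (j : 'I_#|edges G|) : v \in enum_val j -> 0 <= B v j.
  by move=> vj; have [/(_ vj)/ltW] := incB v j.
have s0 j : 0 <= s j.
  by apply: sumr_ge0 => v vj; rewrite mulr_ge0 ?B0// powR_ge0.
have sum_s : \sum_j s j <= 1.
  (* Double counting: after the exchange, each [|x_v|^p] is multiplied by a row sum of [B], at most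
     1 by [rowB]. *)
  rewrite (exchange_big_dep xpredT)//= -x1.
  apply: ler_sum => v _; rewrite -mulr_suml ler_piMl ?powR_ge0//.
have s1 j : s j <= 1.
  by apply: le_trans sum_s; rewrite (bigD1 j)//= lerDl sumr_ge0.
pose M := m%:R `^ (r%:R - p).
have M0 : 0 < M by exact: powR_gt0.
(* Condition (2) divided by [M] bounds the product of [B] over an edge below by [alpha / M], the [c]
   of the edge estimate. *)
pose C := (alpha / M)^-1 `^ p^-1 * r%:R^-1 `^ (r%:R / p).
have edge_le (j : 'I_#|edges G|) : \prod_(v in enum_val j) `|x ord0 v| <= C * s j.
  have cj : #|enum_val j| = r by exact: edges_uniform (enum_valP j).
  have := @prod_norm_le_weighted_sum R _ (enum_val j) (B ^~ j) (x ord0) p (alpha / M).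
  rewrite cj; apply => //.
  - exact: ltW.
  - by rewrite divr_gt0.
  - by move=> v; exact: B0.
  - by rewrite ler_pdivrMr// mulrC /M -hm.
  - exact: s1.
(* The powers of [r] combine to exponent [1 - r/p], and [M] to the [1/p] is [m] to the
   [-(1 - r/p)]. *)
have CK : r%:R * C = K.
  rewrite /K /C /M invf_div [r%:R / m%:R]mulrC.
  rewrite !powRM ?powR_ge0 ?invr_ge0 ?ler0n// ?(ltW halpha)//.
  rewrite !powR_inv_base// ?(ltW halpha)// -powRrM.
  rewrite powRD ?(gt_eqF r0) ?implybT// powRr1// powRN.
  have -> : (r%:R - p) / p = - (1 - r%:R / p) by field; rewrite gt_eqF.
  by rewrite -powRN; ring.
rewrite /lagrangian_poly big_enum_val -CK ler_wpM2l//.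
have C0 : 0 <= C by rewrite mulr_ge0 ?powR_ge0.
apply: (@le_trans _ _ (\sum_j C * s j)); last first.
  by rewrite -mulr_sumr ler_piMr.
apply: ler_sum => j _; apply: le_trans (edge_le j).
by rewrite -normr_prod ler_norm.
Qed.
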